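(* Let $E$ and $G$ be sublattices of vector lattices $F$ and $H$, respectively, such that $E$ is $F$-Dedekind complete and $G$ is $H$-Dedekind complete. Then: (1) A positive linear operator $T:E\to G$ belongs to $L_{FHn}(E,G)$ if and only if for each net $\{x_\alpha\}$ in $E$, $x_\alpha\downarrow_F 0$ implies $Tx_\alpha\downarrow_H 0$. (2) If, in addition, $E$ is an ideal in $F$ and $G$ is an ideal in $H$, then $L_{FHc}(E,G)=L_c(E,G)$; moreover, every $FH$-order continuous operator $T:E\to G$ is order bounded.
   Context: For a sublattice $E$ of a vector lattice $F$, a net $\{x_\alpha\}\subseteq E$ is $F$-order convergent to $x\in E$, written $x_\alpha\xrightarrow{Fo}x$ in $E$, if there is a net $\{y_\beta\}$ in $F$ (possibly with a different index set) with $y_\beta\downarrow 0$ in $F$ (decreasing with infimum $0$ in $F$) such that for each $\beta$ there is $\alpha_0$ with $|x_\alpha-x|\le y_\beta$ for all $\alpha\ge\alpha_0$; similarly $\xrightarrow{Ho}$ in $G$. Order convergence $\xrightarrow{o}$ in $E$ is the case $F=E$. $E$ is $F$-Dedekind complete if every nonempty $A\subseteq E$ bounded from above in $F$ has a supremum in $E$ (similarly for $G$ and $H$). The notation $x_\alpha\downarrow_F x$ means that the net is decreasing and its infimum in $F$ is $x$ (similarly $\downarrow_H$). A linear operator $T:E\to G$ is $FH$-order continuous if, for nets in $E$, $x_\alpha\xrightarrow{Fo}0$ in $E$ implies $Tx_\alpha\xrightarrow{Ho}0$ in $G$; it is $FH$-$\sigma$-order continuous if the same holds for sequences. $L_{FHn}(E,G)$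 (resp. $L_{FHc}(E,G)$) is the set of all $FH$-order continuous (resp. $FH$-$\sigma$-order continuous) linear operators from $E$ to $G$. $L_c(E,G)$ is the set of all $\sigma$-order continuous linear operators, i.e. those mapping sequences order converging to $0$ in $E$ to sequences order converging to $0$ in $G$. $T$ is order bounded if it maps order bounded subsets of $E$ to order bounded subsets of $G$. *)

(* Defs.v *)
From HB Require Import structures.
From mathcomp Require Import all_boot all_order all_algebra.
From mathcomp Require Import all_classical all_reals.

Set Implicit Arguments.
Unset Strict Implicit.
Unset Printing Implicit Defensive.

Import Order.TTheory GRing.Theory Num.Theory.

Local Open Scope classical_set_scope.
Local Open Scope ring_scope.

(* The lattice operations belong to the mixin because the existing hierarchy  *)
(* leaves no room for a common extension of Lmodule and Order.Lattice.        *)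
HB.mixin Record isVectorLattice (R : numDomainType) V
    of GRing.Lmodule R V & Order.POrder ring_display V := {
  vlerD2r : forall z x y : V, x <= y -> x + z <= y + z ;
  vler_wpZ2l : forall (a : R) (x y : V), 0 <= a -> x <= y -> a *: x <= a *: y ;
  vmeet : V -> V -> V ;
  vjoin : V -> V -> V ;
  vlexI : forall x y z : V, (x <= vmeet y z) = (x <= y) && (x <= z) ;
  vleUx : forall x y z : V, (vjoin x y <= z) = (x <= z) && (y <= z)
}.

#[short(type="vectorLatticeType")]
HB.structure Definition VectorLattice (R : numDomainType) :=
  { V of GRing.Lmodule R V & Order.POrder ring_display V
       & isVectorLattice R V }.

Definition vabs (R : numDomainType) (V : vectorLatticeType R) (x : V) : V :=
  vjoin x (- x).

Record vsublattice (R : numDomainType) (F : vectorLatticeType R) :=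
  VSublattice {
    vmem :> {pred F} ;
    vmem_submod : GRing.submod_closed vmem ;
    vmemI : {in vmem &, forall x y, vmeet x y \in vmem} ;
    vmemU : {in vmem &, forall x y, vjoin x y \in vmem}
  }.

(* A sublattice E as a vector lattice in its own right. *)
Record vsub (R : numDomainType) (F : vectorLatticeType R)
    (E : vsublattice F) : Type :=
  VSub { vsub_val : F ; _ : vsub_val \in E }.

Section VSubInstances.
Variables (R : numDomainType) (F : vectorLatticeType R) (E : vsublattice F).

HB.instance Definition _ :=
  GRing.isSubmodClosed.Build R F (vmem E) (vmem_submod E).

HB.instance Definition _ := [isSub of vsub E for @vsub_val R F E].
HB.instance Definition _ := [Choice of vsub E by <:].
HB.instance Definition _ := [SubChoice_isSubZmodule of vsub E by <:].
HB.instance Definition _ := [SubZmodule_isSubLmodule of vsub E by <:].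
HB.instance Definition _ :=
  [SubChoice_isSubPOrder of vsub E by <: with ring_display].

Definition vsub_meet (x y : vsub E) : vsub E :=
  @VSub R F E (vmeet (val x) (val y)) (vmemI (valP x) (valP y)).

Definition vsub_join (x y : vsub E) : vsub E :=
  @VSub R F E (vjoin (val x) (val y)) (vmemU (valP x) (valP y)).

Fact vsub_lerD2r (z x y : vsub E) : x <= y -> x + z <= y + z.
Proof. exact: vlerD2r. Qed.

Fact vsub_ler_wpZ2l (a : R) (x y : vsub E) :
  0 <= a -> x <= y -> a *: x <= a *: y.
Proof. exact: vler_wpZ2l. Qed.

Fact vsub_lexI (x y z : vsub E) :
  (x <= vsub_meet y z) = (x <= y) && (x <= z).
Proof. exact: vlexI. Qed.

Fact vsub_leUx (x y z : vsub E) :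
  (vsub_join x y <= z) = (x <= z) && (y <= z).
Proof. exact: vleUx. Qed.

HB.instance Definition _ := isVectorLattice.Build R (vsub E)
  vsub_lerD2r vsub_ler_wpZ2l vsub_lexI vsub_leUx.

End VSubInstances.

(* Ideals: sublattices that are moreover solid. *)
Definition is_ideal (R : numDomainType) (F : vectorLatticeType R)
    (E : vsublattice F) : Prop :=
  forall x y : F, y \in E -> vabs x <= vabs y -> x \in E.

(* The supremum of A is taken in F and required to lie in E.  Asking only for *)
(* a least element among the upper bounds of A lying in E would be weaker     *)
(* (C(K) in the bounded functions on K, with K infinite, compact and          *)
(* extremally disconnected, has the weaker property only), and too weak for   *)
(* suprema of tails of F-order null nets to decrease to 0 in F.  The two      *)
(* conditions agree when E is an ideal of F.                                  *)
Definition Dedekind_complete_in (R : numDomainType) (F : vectorLatticeType R)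
    (E : vsublattice F) : Prop :=
  forall A : set F, (forall x, A x -> x \in E) -> A !=set0 -> has_ubound A ->
  exists2 s : F, s \in E & supremums A s.

Record directedType := DirectedType {
  dir_sort :> Type ;
  dir_le : dir_sort -> dir_sort -> Prop ;
  dir_refl : forall i, dir_le i i ;
  dir_trans : forall i j k, dir_le i j -> dir_le j k -> dir_le i k ;
  dir_inhab : inhabited dir_sort ;
  dir_ub : forall i j, exists k, dir_le i k /\ dir_le j k
}.

Program Definition nat_directed : directedType :=
  @DirectedType nat (fun m n => (m <= n)%N) leqnn _ _ _.
Next Obligation. by move=> i j k; apply: leq_trans. Qed.
Next Obligation. exact: inhabits 0%N. Qed.
Next Obligation.
by move=> i j; exists (maxn i j); rewrite leq_maxl leq_maxr.
Qed.

Section OrderConvergence.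
Variables (R : numDomainType) (V : vectorLatticeType R).

Definition decreases_to (I : directedType) (x : I -> V) (l : V) : Prop :=
  (forall i j, dir_le i j -> x j <= x i) /\ infimums (range x) l.

Definition order_cvg (I : directedType) (x : I -> V) (l : V) : Prop :=
  exists (J : directedType) (y : J -> V),
    decreases_to y 0 /\
    forall j, exists i0, forall i, dir_le i0 i -> vabs (x i - l) <= y j.

Definition order_bounded (A : set V) : Prop :=
  exists a b : V, forall x, A x -> a <= x <= b.

End OrderConvergence.

Section RelativeOrderConvergence.
Variables (R : numDomainType) (F : vectorLatticeType R) (E : vsublattice F).

Definition decreases_to_in (I : directedType) (x : I -> vsub E) (l : vsub E) :
  Prop := decreases_to (fun i => val (x i)) (val l).

Definition order_cvg_in (I : directedType) (x : I -> vsub E) (l : vsub E) :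
  Prop := order_cvg (fun i => val (x i)) (val l).

End RelativeOrderConvergence.

Section Operators.
Variables (R : numDomainType) (F H : vectorLatticeType R).
Variables (E : vsublattice F) (G : vsublattice H).

Definition positive_op (T : {linear vsub E -> vsub G}) : Prop :=
  forall x : vsub E, 0 <= x -> 0 <= T x.

Definition order_bounded_op (T : {linear vsub E -> vsub G}) : Prop :=
  forall A : set (vsub E), order_bounded A -> order_bounded (T @` A).

Definition L_FHn : set {linear vsub E -> vsub G} :=
  [set T | forall (I : directedType) (x : I -> vsub E),
     order_cvg_in x 0 -> order_cvg_in (fun i => T (x i)) 0].

Definition L_FHc : set {linear vsub E -> vsub G} :=
  [set T | forall x : nat_directed -> vsub E,
     order_cvg_in x 0 -> order_cvg_in (fun n => T (x n)) 0].

Definition L_c : set {linear vsub E -> vsub G} :=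
  [set T | forall x : nat_directed -> vsub E,
     order_cvg x 0 -> order_cvg (fun n => T (x n)) 0].

End Operators.

Arguments L_FHn {R F H} E G.
Arguments L_FHc {R F H} E G.
Arguments L_c {R F H} E G.

(* Main.v *)
(* An F-order null net in E is dominated by the suprema of its tails, which   *)
(* lie in E by F-Dedekind completeness and decrease to 0 in F; a positive     *)
(* operator carries this domination to G.  When E is an ideal, a lower bound  *)
(* z in F of a positive net of E has its positive part in E, so decreasing to *)
(* 0 means the same in E and in F.                                            *)
Require Import Defs.
From HB Require Import structures.
From mathcomp Require Import all_boot all_order all_algebra.
From mathcomp Require Import all_classical all_reals.

Import Order.TTheory GRing.Theory Num.Theory.

Local Open Scope classical_set_scope.
Local Open Scope ring_scope.

(** For (1), a net decreasing to 0 dominates itself, so an [FH]-order continuous [T] sends it to a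
    net dominated in [H] by one with infimum 0, which forces infimum 0 on the image. The converse
    replaces a dominating net in [F] by one in [E] ([order_cvg_in_dominated]), to which [T] can be
    applied. For ideals the same replacement identifies order null nets with [F]-order null nets
    ([ideal_order_cvg_in]), hence the equality in (2). Order boundedness holds because the
    [y / (n + 1)] with [|y| <= u] tend to 0 uniformly in [y], [u] being Archimedean by Dedekind
    completeness; continuity then bounds [T] on all such [y] at once. *)

Section VectorLatticeTheory.
Context {R : numFieldType} {V : vectorLatticeType R}.
Implicit Types x y z : V.

Lemma vlerN2 x y : x <= y -> - y <= - x.
Proof.
by move=> /(vlerD2r (- x - y)); rewrite addrA subrr add0r addrCA subrr addr0.
Qed.

Lemma vabs_le x y : (vabs x <= y) = (x <= y) && (- x <= y).
Proof. exact: vleUx. Qed.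

Lemma vler_abs x : x <= vabs x.
Proof. by have := lexx (vabs x); rewrite vabs_le => /andP[]. Qed.

Lemma vlerN_abs x : - x <= vabs x.
Proof. by have := lexx (vabs x); rewrite vabs_le => /andP[]. Qed.

Lemma vscale_nat2 x : 2%:R *: x = x + x.
Proof. by rewrite scaler_nat mulr2n. Qed.

Lemma vabs_ge0 x : 0 <= vabs x.
Proof.
(* Add [x <= vabs x] and [- x <= vabs x], then halve. *)
have abs2 : 0 <= 2%:R *: vabs x.
  rewrite vscale_nat2 -(addNr x).
  apply: le_trans (vlerD2r x _ _ (vlerN_abs x)) _.
  by rewrite addrC; exact: vlerD2r (vler_abs x).
have half0 : 0 <= 2%:R^-1 :> R by rewrite invr_ge0 ler0n.
have := vler_wpZ2l _ _ _ half0 abs2.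
by rewrite scaler0 scalerA mulVf ?pnatr_eq0// scale1r.
Qed.

Lemma ger0_vabs x : 0 <= x -> vabs x = x.
Proof.
move=> x0; apply: le_anti; rewrite vler_abs andbT vabs_le lexx /=.
by apply: (le_trans _ x0); rewrite -(oppr0 V); exact: vlerN2.
Qed.

Lemma vabsZ_le (a : R) x y : 0 <= a -> vabs x <= y -> vabs (a *: x) <= a *: y.
Proof.
move=> a0; rewrite !vabs_le -scalerN => /andP[xy Nxy].
by rewrite !vler_wpZ2l.
Qed.

Lemma vler_wpZ2r (a b : R) x : 0 <= x -> a <= b -> a *: x <= b *: x.
Proof.
move=> x0; rewrite -subr_ge0 => /vler_wpZ2l/(_ x0).
by rewrite scaler0 scalerBl => /(vlerD2r (a *: x)); rewrite add0r subrK.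
Qed.

Lemma vabs_itv_le {a b x} : a <= x <= b -> vabs x <= vjoin (vabs a) (vabs b).
Proof.
have := lexx (vjoin (vabs a) (vabs b)); rewrite vleUx => /andP[au bu].
move=> /andP[ax xb]; rewrite vabs_le (le_trans xb (le_trans (vler_abs b) bu)).
by rewrite (le_trans (vlerN2 _ _ ax) (le_trans (vlerN_abs a) au)).
Qed.

Lemma decreases_to_order_cvg0 (I : directedType) (x : I -> V) :
  decreases_to x 0 -> order_cvg x 0.
Proof.
move=> x0; exists I, x; split=> // i; exists i => j ij.
case: x0 => xdec [lb _]; rewrite subr0 ger0_vabs ?xdec//.
by apply: lb; exists j.
Qed.

End VectorLatticeTheory.

Section RelativeOrder.
Context {R : numFieldType} {F : vectorLatticeType R} {E : vsublattice F}.

Lemma val_vsub0 : val (0 : vsub E) = 0.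
Proof. exact: raddf0. Qed.

Lemma val_vsubZ (a : R) (x : vsub E) : val (a *: x) = a *: val x.
Proof. exact: linearZ. Qed.

Lemma val_vabs (x : vsub E) : val (vabs x) = vabs (val x).
Proof. by []. Qed.

Lemma ideal_decreases_to_in (I : directedType) (x : I -> vsub E) :
  is_ideal E -> decreases_to x 0 <-> decreases_to_in x 0.
Proof.
move=> idE; split=> -[xdec [lb glb]]; (split; first exact: xdec); split.
- by move=> _ [i _ <-]; apply: (lb (x i)); exists i.
- move=> z zlb; have [i0] := dir_inhab I.
  have lezp y : (vjoin z 0 <= y) = (z <= y) && (0 <= y) by exact: vleUx.
  have zp0 : 0 <= vjoin z 0.
    by have := lexx (vjoin z 0); rewrite lezp => /andP[].
  have zpx i : vjoin z 0 <= val (x i).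
    rewrite lezp; apply/andP; split; first by apply: zlb; exists i.
    by apply: (lb (x i)); exists i.
  (* [z] may lie outside [E], but its positive part is squeezed between 0 and [x i0], so solidity
     applies. *)
  have zpE : vjoin z 0 \in E.
    apply: (idE _ (val (x i0)) (valP (x i0))).
    by rewrite ger0_vabs// (le_trans (zpx i0))// vler_abs.
  have zp_le0 : (VSub zpE : vsub E) <= 0.
    by apply: glb => _ [i _ <-]; exact: zpx.
  have : vjoin z 0 <= 0 := zp_le0.
  by rewrite lezp => /andP[].
- by move=> _ [i _ <-]; apply: (lb (val (x i))); exists i.
- move=> z zlb; apply: (glb (val z)) => _ [i _ <-].
  by apply: (zlb (x i)); exists i.
Qed.

Lemma order_cvg_in_dominated (I : directedType) (x : I -> vsub E) :
  Dedekind_complete_in E -> order_cvg_in x 0 ->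
  exists (J : directedType) (s : J -> vsub E), decreases_to_in s 0 /\
    forall j, exists i0, forall i, dir_le i0 i -> vabs (x i) <= s j.
Proof.
move=> dcE [K [y [[_ [ylb yglb]] xy]]].
pose tail i := [set vabs (val (x k)) | k in [set k | dir_le i k]].
have tailS i j : dir_le i j -> tail j `<=` tail i.
  by move=> ij _ [k jk <-]; exists k => //; exact: dir_trans jk.
(* Early tails may be unbounded in [F] and have no supremum, so the new net is indexed only by the
   [i] with bounded tail, an upward closed set. *)
pose P i := has_ubound (tail i).
have PS i j : dir_le i j -> P i -> P j.
  by move=> ij [u ub]; exists u => v /(tailS _ _ ij)/ub.
have yP k : exists2 i, P i & ubound (tail i) (y k).
  have [i yi] := xy k.
  suff ub : ubound (tail i) (y k) by exists i => //; exists (y k).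
  by move=> _ [j ij <-]; have := yi j ij; rewrite val_vsub0 subr0.
have Jinh : inhabited {i | P i}.
  have [k0] := dir_inhab K; have [i Pi _] := yP k0.
  exact: inhabits (exist _ i Pi).
have Jub (i j : {i | P i}) : exists k : {i | P i},
    dir_le (sval i) (sval k) /\ dir_le (sval j) (sval k).
  have [k [ik jk]] := dir_ub (sval i) (sval j).
  by exists (exist _ k (PS _ _ ik (svalP i))).
pose J := @DirectedType {i | P i} (fun i j => dir_le (sval i) (sval j))
  (fun i => dir_refl (sval i)) (fun i j k => @dir_trans _ _ _ _) Jinh Jub.
have supE (j : J) : exists s : vsub E, supremums (tail (sval j)) (val s).
  have [|||s sE ss] := dcE (tail (sval j)); last by exists (VSub sE).
  - by move=> _ [k _ <-]; rewrite -val_vabs; exact: valP.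
  - by exists (vabs (val (x (sval j)))), (sval j) => //; exact: dir_refl.
  - exact: (svalP j).
have [s sP] := choice supE.
exists J, s; split; last first.
  by move=> j; exists (sval j) => i ji; apply: (sP j).1; exists i.
split=> [i j ij|]; first by apply: (sP j).2 => v /(tailS _ _ ij)/(sP i).1.
rewrite val_vsub0; split=> [_ [j _ <-]|z zlb].
  apply: le_trans (vabs_ge0 (val (x (sval j)))) _; apply: (sP j).1.
  by exists (sval j) => //; exact: dir_refl.
(* Each [y k] bounds a whole tail, hence its supremum, so a lower bound of the suprema lies below
   every [y k]. *)
apply: yglb => _ [k _ <-]; have [i Pi ub] := yP k.
apply: (le_trans _ ((sP (exist _ i Pi)).2 _ ub)).
by apply: zlb; exists (exist _ i Pi).
Qed.

(** Both notions are witnessed by a dominating net in [E], and for such nets the infimum 0 in [E]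
    and in [F] agree. *)
Lemma ideal_order_cvg_in (I : directedType) (x : I -> vsub E) :
  Dedekind_complete_in E -> is_ideal E ->
  order_cvg_in x 0 <-> order_cvg x 0.
Proof.
move=> dcE idE; split.
  move=> /(order_cvg_in_dominated _ _ dcE)[J [s [s0 xs]]].
  exists J, s; split; first exact/ideal_decreases_to_in.
  by move=> j; have [i0 xi0] := xs j; exists i0 => i /xi0; rewrite subr0.
move=> [J [s [/(ideal_decreases_to_in _ _ idE) s0 xs]]].
exists J, (fun j => val (s j)); split; first by rewrite -val_vsub0.
by move=> j; have [i0 xi0] := xs j; exists i0 => i /xi0.
Qed.

(* The supremum t of the - u / (n + 1) satisfies t <= t + t, by comparing the *)
(* terms of indices n and 2 n + 1.                                            *)
Lemma Dedekind_complete_in_archimedean (u : F) :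
  Dedekind_complete_in E -> u \in E -> 0 <= u ->
  @decreases_to R F nat_directed (fun n => n.+1%:R^-1 *: u) 0.
Proof.
move=> dcE uE u0.
have un0 n : 0 <= n.+1%:R^-1 *: u.
  by rewrite -(scaler0 F (n.+1%:R^-1)) vler_wpZ2l// invr_ge0 ler0n.
split=> [m n /= mn|].
  by apply: vler_wpZ2r => //; rewrite lef_pV2 ?posrE ?ltr0n// ler_nat.
split=> [_ [n _ <-]//|z zlb].
have [|||t tE [tub tlub]] := dcE [set - (n.+1%:R^-1 *: u) | n in setT].
- by move=> _ [n _ <-]; rewrite rpredN rpredZ.
- by exists (- (1%:R^-1 *: u)), 0%N.
- by exists 0 => _ [n _ <-]; rewrite -(oppr0 F); exact: vlerN2.
have t0 : 0 <= t.
  rewrite -(subrr t) -[leRHS](addrK t); apply: vlerD2r.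
  apply: tlub => _ [n _ <-].
  have half : n.+1%:R^-1 *: u = 2%:R *: ((n.*2.+1).+1%:R^-1 *: u).
    rewrite scalerA; congr (_ *: _).
    by rewrite -doubleS -muln2 natrM invfM mulrCA divff ?mulr1 ?pnatr_eq0.
  have le_t : - ((n.*2.+1).+1%:R^-1 *: u) <= t by apply: tub; exists n.*2.+1.
  rewrite half -scalerN -vscale_nat2; exact: vler_wpZ2l.
(* [z] ranges over [F]: this uses that [t] is least among the upper bounds in [F], not only in
   [E]. *)
have tNz : t <= - z.
  by apply: tlub => _ [n _ <-]; apply: vlerN2; apply: zlb; exists n.
by rewrite -[z]opprK -(oppr0 F); apply: vlerN2; exact: le_trans t0 tNz.
Qed.

End RelativeOrder.

Section Operators.
Context {R : numFieldType} {F H : vectorLatticeType R}.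
Context {E : vsublattice F} {G : vsublattice H}.
Context (T : {linear vsub E -> vsub G}).

Lemma positive_op_le (x y : vsub E) : positive_op T -> x <= y -> T x <= T y.
Proof.
move=> Tp /(vlerD2r (- x)); rewrite subrr => /Tp; rewrite raddfB.
by move=> /(vlerD2r (T x)); rewrite add0r subrK.
Qed.

Lemma positive_op_vabs (x : vsub E) : positive_op T -> vabs (T x) <= T (vabs x).
Proof.
move=> Tp; rewrite vabs_le -raddfN.
by rewrite !positive_op_le ?vler_abs ?vlerN_abs.
Qed.

Lemma positive_L_FHnP : Dedekind_complete_in E -> positive_op T ->
  L_FHn E G T <->
  forall (I : directedType) (x : I -> vsub E),
    decreases_to_in x 0 -> decreases_to_in (fun i => T (x i)) 0.
Proof.
move=> dcE Tp; split=> [Tc I x x0|Td I x].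
  have [xdec [xlb _]] := x0.
  have [|J [y [[_ [_ yglb]] Ty]]] := Tc I x.
    rewrite /order_cvg_in val_vsub0; apply: decreases_to_order_cvg0.
    by rewrite -(@val_vsub0 _ _ E).
  split=> [i j ij|]; first by apply: positive_op_le => //; exact: xdec.
  rewrite val_vsub0; split=> [_ [i _ <-]|z zlb].
    by apply: Tp; apply: (xlb (val (x i))); exists i.
  (* [z <= T (x i0) <= vabs (T (x i0)) <= y j]. *)
  apply: yglb => _ [j _ <-]; have [i0 Tyi] := Ty j.
  have := Tyi i0 (dir_refl i0); rewrite val_vsub0 subr0; apply: le_trans.
  by apply: le_trans (vler_abs _); apply: zlb; exists i0.
move=> /(order_cvg_in_dominated _ _ dcE)[J [s [/Td Ts xs]]].
exists J, (fun j => val (T (s j))); split; first by rewrite -(@val_vsub0 _ _ G).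
move=> j; have [i0 xi0] := xs j; exists i0 => i /xi0 xisj.
rewrite val_vsub0 subr0 -val_vabs.
exact: le_trans (positive_op_vabs (x i) Tp) (positive_op_le _ _ Tp xisj).
Qed.

(* Index y / (n + 1) by the pairs (n, y), |y| <= u, preordered by n alone: a  *)
(* single element of a dominating net for the images bounds T [-u, u] up to a *)
(* scalar.                                                                    *)
Lemma L_FHn_order_bounded : Dedekind_complete_in E -> Dedekind_complete_in G ->
  L_FHn E G T -> order_bounded_op T.
Proof.
move=> dcE dcG Tc A [a [b Aab]].
pose u := vjoin (vabs a) (vabs b).
have u0 : 0 <= u.
  by have := lexx u; rewrite vleUx => /andP[/(le_trans (vabs_ge0 a))].
have Au y : A y -> vabs y <= u by move=> /Aab; exact: vabs_itv_le.
pose U := {y : vsub E | vabs y <= u}.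
have U0 : vabs (0 : vsub E) <= u by rewrite ger0_vabs.
have Iub (p q : nat * U) : exists r : nat * U, (p.1 <= r.1)%N /\ (q.1 <= r.1)%N.
  by exists (maxn p.1 q.1, p.2); rewrite leq_maxl leq_maxr.
pose I := @DirectedType (nat * U)%type (fun p q => (p.1 <= q.1)%N)
  (fun p => leqnn p.1) (fun p q r => @leq_trans _ _ _)
  (inhabits (0%N, exist _ 0 U0)) Iub.
pose x (p : I) : vsub E := p.1.+1%:R^-1 *: sval p.2.
have x0 : order_cvg_in x 0.
  have ud := Dedekind_complete_in_archimedean _ dcE (valP u) u0.
  exists nat_directed, (fun n => n.+1%:R^-1 *: val u); split=> // n.
  exists (n, exist _ 0 U0) => p np; rewrite val_vsub0 subr0.
  apply: (le_trans _ (ud.1 _ _ np)).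
  rewrite val_vsubZ; apply: vabsZ_le; first by rewrite invr_ge0 ler0n.
  exact: (svalP p.2).
have [K [w [_ Tw]]] := Tc I x x0.
have [k0] := dir_inhab K; have [[n y0] Tn] := Tw k0.
have Tb (y : vsub E) : vabs y <= u -> vabs (val (T y)) <= n.+1%:R *: w k0.
  (* The preorder ignores the second component, so [(n, y)] is above [(n, y0)] for every [y]. *)
  move=> yu; have := Tn (n, exist _ y yu) (leqnn n).
  rewrite val_vsub0 subr0 /x linearZ val_vsubZ /=.
  move=> /(vabsZ_le n.+1%:R _ _ (ler0n _ _)).
  by rewrite scalerA divff ?pnatr_eq0// scale1r.
(* The bound found so far lies only in [H]; completeness of [G] replaces it by one in [G]. *)
have [|||s sG [sub _]] := dcG
  [set vabs (val (T y)) | y in [set y | vabs y <= u]].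
- by move=> _ [y _ <-]; rewrite -val_vabs; exact: valP.
- by exists (vabs (val (T 0))), 0.
- by exists (n.+1%:R *: w k0) => _ [y /Tb Ty <-].
exists (- VSub sG), (VSub sG) => _ [y /Au yu <-].
have : vabs (T y) <= VSub sG :> vsub G by apply: sub; exists y.
by rewrite vabs_le => /andP[-> /vlerN2]; rewrite opprK => ->.
Qed.

End Operators.

Theorem lemma3p2 (R : realType) (F H : vectorLatticeType R)
    (E : vsublattice F) (G : vsublattice H) :
  Dedekind_complete_in E -> Dedekind_complete_in G ->
  (forall T : {linear vsub E -> vsub G}, positive_op T ->
     L_FHn E G T <->
     forall (I : directedType) (x : I -> vsub E),
       decreases_to_in x 0 -> decreases_to_in (fun i => T (x i)) 0) /\
  (is_ideal E -> is_ideal G ->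
     L_FHc E G = L_c E G /\
     forall T : {linear vsub E -> vsub G}, L_FHn E G T -> order_bounded_op T).
Proof.
move=> dcE dcG; split=> [T Tp|idE idG]; first exact: positive_L_FHnP.
split=> [|T]; last exact: L_FHn_order_bounded.
by apply/seteqP; split=> T Tc x /ideal_order_cvg_in xc;
  apply/ideal_order_cvg_in => //; apply: Tc; exact: xc.
Qed.
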